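(* Let $d\ge1$ and let $P$ be the algebra of operators on $\mathscr{F}_+$ generated by $e_i,f_i$ $(1\le i\le d)$ and $K$, with basis $\Omega=\{(\prod_{i=1}^de_i^{m_i}f_i^{n_i})K^\ell\mid m_i,n_i,\ell\in\{0,1\}\}$. The center $Z(P)$ of $P$ has a basis $Z(\Omega)\subset\Omega$ which consists of the monomials $\prod_{i=1}^de_i^{m_i}f_i^{n_i}$ in the $e_i$ and $f_i$ of even length $\sum_i(m_i+n_i)$, together with $\bigl(\prod_{i=1}^de_if_i\bigr)K$. In particular, $\dim_{\mathbb{C}}Z(P)=2^{2d-1}+1$.
   Context: Let $\mathfrak{h}$ be a $2d$-dimensional complex vector space with a non-degenerate skew-symmetric form $\langle\,,\rangle$ and a basis $\{\phi^i,\psi^i\}_{i=1}^d$ with $\langle\phi^i,\phi^j\rangle=\langle\psi^i,\psi^j\rangle=0$, $\langle\phi^i,\psi^j\rangle=-\langle\psi^j,\phi^i\rangle=-\delta_{ij}$. Let $\mathscr{A}$ be the associative unital superalgebra generated by odd elements $h_n$ ($h\in\mathfrak{h}$, $n\in\mathbb{Z}$), linear in $h$, with relations $h_mh'_n+h'_nh_m=m\langle h,h'\rangle\delta_{m+n,0}$. Let $\mathscr{F}_+=\mathscr{A}/\mathscr{A}_+$, where $\mathscr{A}_+$ is the left ideal generated by all $h_n$ with $n>0$, and let $|0\rangle_+$ be the image of $1$. $\mathscr{F}_+$ is spanned by $h^1_{-n_1}\cdots h^r_{-n_r}|0\rangle_+$ with $n_j\ge0$; its even part $\mathscr{F}_+^+$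 (odd part $\mathscr{F}_+^-$) is spanned by those with $r$ even (odd). On $\mathscr{F}_+$ put $e_i=\phi^i_0$, $f_i=\psi^i_0$ (action of elements of $\mathscr{A}$), and let $K$ be the operator acting as $+1$ on $\mathscr{F}_+^+$ and $-1$ on $\mathscr{F}_+^-$. $P$ is the subalgebra of $\mathrm{End}_{\mathbb{C}}(\mathscr{F}_+)$ generated by all $e_i,f_i$ and $K$ (these operators commute with the action on $\mathscr{F}_+$ of $\mathscr{F}^+$, the even part of the symplectic fermionic vertex operator superalgebra, so $P\subset\mathrm{End}_{\mathscr{F}^+}(\mathscr{F}_+)$). The product $\prod_{i=1}^de_i^{m_i}f_i^{n_i}$ is ordered as $e_1^{m_1}f_1^{n_1}e_2^{m_2}f_2^{n_2}\cdots$; the set $\Omega$ is a basis of $P$. *)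

(* Defs.v *)
From HB Require Import structures.
From mathcomp Require Import all_boot all_order all_algebra.
From mathcomp Require Import generic_quotient ring_quotient.
From mathcomp Require Import boolp classical_sets functions cardinality.
From mathcomp Require Import reals complex.

Set Implicit Arguments.
Unset Strict Implicit.
Unset Printing Implicit Defensive.

Import GRing.Theory.
Local Open Scope ring_scope.
Local Open Scope classical_set_scope.
Local Open Scope card_scope.
Local Open Scope quotient_scope.

Section LinearAlgebra.
Context {k : fieldType} {V : lmodType k}.
Implicit Types B S : set V.

Definition is_subspace S :=
  S 0 /\ forall (a : k) u v, S u -> S v -> S (a *: u + v).

Definition span B : set V := smallest is_subspace B.

Definition lin_indep B := forall (s : seq V) (c : V -> k),
  uniq s -> [set` s] `<=` B ->
  \sum_(v <- s) c v *: v = 0 -> forall v, v \in s -> c v = 0.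

Definition is_basis B S := lin_indep B /\ span B = S.

Definition has_dim S (n : nat) := exists B, is_basis B S /\ B #= `I_n.

Definition linear_ops : set (V -> V) := [set f | linear f].

End LinearAlgebra.

Section OperatorAlgebra.
Context {k : fieldType} {V : lmodType k}.
Implicit Types S G : set (V -> V).

Definition is_subalgebra S :=
  [/\ S `<=` linear_ops, is_subspace S, S id &
      forall f g, S f -> S g -> S (f \o g)].

Definition generated_algebra G : set (V -> V) := smallest is_subalgebra G.

Definition center S : set (V -> V) :=
  [set z | S z /\ forall f, S f -> z \o f = f \o z].

End OperatorAlgebra.

Section Symplectic.
Context {k : fieldType} {h : vectType k}.

Record symplectic_form (form : h -> h -> k) : Prop := {
  form_linearl : forall v, scalar (form^~ v);
  form_linearr : forall u, scalar (form u);
  form_skew : forall u v, form u v = - form v u;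
  form_nondeg : forall u, (forall v, form u v = 0) -> u = 0
}.

Record symplectic_basis (form : h -> h -> k) (d : nat) (phi psi : 'I_d -> h)
    : Prop := {
  sb_basis : basis_of fullv (codom phi ++ codom psi);
  sb_phi : forall i j, form (phi i) (phi j) = 0;
  sb_psi : forall i j, form (psi i) (psi j) = 0;
  sb_phi_psi : forall i j, form (phi i) (psi j) = - (i == j)%:R;
  sb_psi_phi : forall i j, form (psi j) (phi i) = (i == j)%:R
}.

End Symplectic.

(* The algebra [sf_alg form] is presented by generators and relations: it is
   the set of formal expressions in the symbols h_n, modulo the smallest
   congruence [sf_eq] containing the axioms of unital associative k-algebras,
   linearity of h |-> h_n, and the anticommutation relations. *)
Inductive sf_expr (k h : Type) : Type :=
| EGen of h & int
| EZero
| EOne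
| EAdd of sf_expr k h & sf_expr k h
| EOpp of sf_expr k h
| EMul of sf_expr k h & sf_expr k h
| EScale of k & sf_expr k h.
Arguments EGen {k h}.
Arguments EZero {k h}.
Arguments EOne {k h}.

HB.instance Definition _ (k h : Type) := gen_eqMixin (sf_expr k h).
HB.instance Definition _ (k h : Type) := gen_choiceMixin (sf_expr k h).

Section Presentation.
Variables (k : fieldType) (h : lmodType k) (form : h -> h -> k).
Local Notation expr := (sf_expr k h).

Inductive sf_eq : expr -> expr -> Prop :=
| sf_refl x : sf_eq x x
| sf_sym x y : sf_eq x y -> sf_eq y x
| sf_trans x y z : sf_eq x y -> sf_eq y z -> sf_eq x z
| sf_cAdd x x' y y' :
    sf_eq x x' -> sf_eq y y' -> sf_eq (EAdd x y) (EAdd x' y')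
| sf_cOpp x x' : sf_eq x x' -> sf_eq (EOpp x) (EOpp x')
| sf_cMul x x' y y' :
    sf_eq x x' -> sf_eq y y' -> sf_eq (EMul x y) (EMul x' y')
| sf_cScale a x x' : sf_eq x x' -> sf_eq (EScale a x) (EScale a x')
| sf_addA x y z : sf_eq (EAdd x (EAdd y z)) (EAdd (EAdd x y) z)
| sf_addC x y : sf_eq (EAdd x y) (EAdd y x)
| sf_add0 x : sf_eq (EAdd EZero x) x
| sf_addN x : sf_eq (EAdd (EOpp x) x) EZero
| sf_mulA x y z : sf_eq (EMul x (EMul y z)) (EMul (EMul x y) z)
| sf_mul1l x : sf_eq (EMul EOne x) x
| sf_mul1r x : sf_eq (EMul x EOne) x
| sf_mulDl x y z : sf_eq (EMul (EAdd x y) z) (EAdd (EMul x z) (EMul y z))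
| sf_mulDr x y z : sf_eq (EMul x (EAdd y z)) (EAdd (EMul x y) (EMul x z))
| sf_scaleA a b x : sf_eq (EScale a (EScale b x)) (EScale (a * b) x)
| sf_scale1 x : sf_eq (EScale 1 x) x
| sf_scaleDr a x y :
    sf_eq (EScale a (EAdd x y)) (EAdd (EScale a x) (EScale a y))
| sf_scaleDl a b x :
    sf_eq (EScale (a + b) x) (EAdd (EScale a x) (EScale b x))
| sf_scaleAl a x y : sf_eq (EScale a (EMul x y)) (EMul (EScale a x) y)
| sf_scaleAr a x y : sf_eq (EScale a (EMul x y)) (EMul x (EScale a y))
| sf_gen_linear a (u v : h) n :
    sf_eq (EGen (a *: u + v) n) (EAdd (EScale a (EGen u n)) (EGen v n))
| sf_gen_comm (u v : h) (m n : int) :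
    sf_eq (EAdd (EMul (EGen u m) (EGen v n)) (EMul (EGen v n) (EGen u m)))
          (EScale (m%:~R * form u v *+ (m + n == 0)) EOne).

Definition sf_eqb (x y : expr) : bool := `[< sf_eq x y >].

Lemma sf_eqb_equiv : equiv_class_of sf_eqb.
Proof.
split=> [x|x y|y x z].
- exact/asboolP/sf_refl.
- by apply/asboolP/asboolP; apply: sf_sym.
- by move=> /asboolP xy /asboolP yz; apply/asboolP; apply: sf_trans xy yz.
Qed.
Canonical sf_eqb_equivrel := EquivRelPack sf_eqb_equiv.

Definition sf_alg := {eq_quot sf_eqb}.
HB.instance Definition _ := Choice.on sf_alg.
HB.instance Definition _ : EqQuotient expr sf_eqb sf_alg := EqQuotient.on sf_alg.

Lemma sf_piP (x y : expr) :
  sf_eq x y <-> \pi_(sf_alg)%qT x = \pi_(sf_alg)%qT y.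
Proof.
by split=> [xy|/eqmodP/asboolP //]; apply/eqmodP/asboolP.
Qed.

Lemma sf_reprP (x : expr) : sf_eq (repr (\pi_(sf_alg)%qT x)) x.
Proof. by apply/sf_piP; rewrite reprK. Qed.

Definition sf_class (x : expr) : sf_alg := \pi_(sf_alg)%qT x.
Local Notation A_ := sf_class.

Definition sf_add (x y : sf_alg) : sf_alg := A_ (EAdd (repr x) (repr y)).
Definition sf_opp (x : sf_alg) : sf_alg := A_ (EOpp (repr x)).
Definition sf_mul (x y : sf_alg) : sf_alg := A_ (EMul (repr x) (repr y)).
Definition sf_scale a (x : sf_alg) : sf_alg := A_ (EScale a (repr x)).

Fact sf_pi_add x y : sf_add (A_ x) (A_ y) = A_ (EAdd x y).
Proof. by apply/sf_piP; apply: sf_cAdd; apply: sf_reprP. Qed.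
Fact sf_pi_opp x : sf_opp (A_ x) = A_ (EOpp x).
Proof. by apply/sf_piP; apply: sf_cOpp; apply: sf_reprP. Qed.
Fact sf_pi_mul x y : sf_mul (A_ x) (A_ y) = A_ (EMul x y).
Proof. by apply/sf_piP; apply: sf_cMul; apply: sf_reprP. Qed.
Fact sf_pi_scale a x : sf_scale a (A_ x) = A_ (EScale a x).
Proof. by apply/sf_piP; apply: sf_cScale; apply: sf_reprP. Qed.
Local Definition sf_piE := (sf_pi_add, sf_pi_opp, sf_pi_mul, sf_pi_scale).

Fact sf_ind (P : sf_alg -> Prop) : (forall x, P (A_ x)) -> forall x, P x.
Proof. by move=> Px x; rewrite -[x]reprK; apply: Px. Qed.

Fact sf_addrA : associative sf_add.
Proof.
elim/sf_ind => x; elim/sf_ind => y; elim/sf_ind => z.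
by rewrite !sf_piE; apply/sf_piP/sf_addA.
Qed.
Fact sf_addrC : commutative sf_add.
Proof.
by elim/sf_ind => x; elim/sf_ind => y; rewrite !sf_piE; apply/sf_piP/sf_addC.
Qed.
Fact sf_add0r : left_id (A_ EZero) sf_add.
Proof. by elim/sf_ind => x; rewrite !sf_piE; apply/sf_piP/sf_add0. Qed.
Fact sf_addNr : left_inverse (A_ EZero) sf_opp sf_add.
Proof. by elim/sf_ind => x; rewrite !sf_piE; apply/sf_piP/sf_addN. Qed.
HB.instance Definition _ :=
  GRing.isZmodule.Build sf_alg sf_addrA sf_addrC sf_add0r sf_addNr.

Fact sf_mulrA : associative sf_mul.
Proof.
elim/sf_ind => x; elim/sf_ind => y; elim/sf_ind => z.
by rewrite !sf_piE; apply/sf_piP/sf_mulA.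
Qed.
Fact sf_mul1rl : left_id (A_ EOne) sf_mul.
Proof. by elim/sf_ind => x; rewrite !sf_piE; apply/sf_piP/sf_mul1l. Qed.
Fact sf_mul1rr : right_id (A_ EOne) sf_mul.
Proof. by elim/sf_ind => x; rewrite !sf_piE; apply/sf_piP/sf_mul1r. Qed.
Fact sf_mulrDl : left_distributive sf_mul sf_add.
Proof.
elim/sf_ind => x; elim/sf_ind => y; elim/sf_ind => z.
by rewrite !sf_piE; apply/sf_piP/sf_mulDl.
Qed.
Fact sf_mulrDr : right_distributive sf_mul sf_add.
Proof.
elim/sf_ind => x; elim/sf_ind => y; elim/sf_ind => z.
by rewrite !sf_piE; apply/sf_piP/sf_mulDr.
Qed.
HB.instance Definition _ := GRing.Zmodule_isPzRing.Build sf_alg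
  sf_mulrA sf_mul1rl sf_mul1rr sf_mulrDl sf_mulrDr.

Fact sf_scalerA a b x : sf_scale a (sf_scale b x) = sf_scale (a * b) x.
Proof. by elim/sf_ind: x => x; rewrite !sf_piE; apply/sf_piP/sf_scaleA. Qed.
Fact sf_scale1r : left_id 1 sf_scale.
Proof. by elim/sf_ind => x; rewrite !sf_piE; apply/sf_piP/sf_scale1. Qed.
Fact sf_scalerDr : right_distributive sf_scale +%R.
Proof.
move=> a; elim/sf_ind => x; elim/sf_ind => y.
by rewrite /GRing.add /= !sf_piE; apply/sf_piP/sf_scaleDr.
Qed.
Fact sf_scalerDl x : {morph sf_scale^~ x : a b / a + b}.
Proof.
move=> a b; elim/sf_ind: x => x.
by rewrite [RHS]/GRing.add /= !sf_piE; apply/sf_piP/sf_scaleDl.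
Qed.
HB.instance Definition _ := GRing.Zmodule_isLmodule.Build k sf_alg
  sf_scalerA sf_scale1r sf_scalerDr sf_scalerDl.

Lemma sf_scalerAl a (x y : sf_alg) : a *: (x * y) = a *: x * y.
Proof.
elim/sf_ind: x => x; elim/sf_ind: y => y.
by rewrite /GRing.mul /GRing.scale /= !sf_piE; apply/sf_piP/sf_scaleAl.
Qed.
Lemma sf_scalerAr a (x y : sf_alg) : a *: (x * y) = x * (a *: y).
Proof.
elim/sf_ind: x => x; elim/sf_ind: y => y.
by rewrite /GRing.mul /GRing.scale /= !sf_piE; apply/sf_piP/sf_scaleAr.
Qed.

Definition sf_gen (u : h) (n : int) : sf_alg := A_ (EGen u n).

Lemma sf_gen_linearP n : linear (sf_gen^~ n).
Proof.
move=> a u v; rewrite -[RHS]/(sf_add (sf_scale a (A_ (EGen u n))) (sf_gen v n)).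
by rewrite sf_pi_scale sf_pi_add; apply/sf_piP; apply: sf_gen_linear.
Qed.

Lemma sf_gen_commP u v m n :
  sf_gen u m * sf_gen v n + sf_gen v n * sf_gen u m
  = (m%:~R * form u v *+ (m + n == 0)) *: (1 : sf_alg).
Proof.
rewrite -[LHS]/(sf_add (sf_mul (sf_gen u m) (sf_gen v n))
                      (sf_mul (sf_gen v n) (sf_gen u m))).
rewrite -[RHS]/(sf_scale _ (A_ EOne)) sf_pi_scale !sf_pi_mul sf_pi_add.
by apply/sf_piP; apply: sf_gen_comm.
Qed.

Definition is_left_ideal (I : set sf_alg) :=
  [/\ I 0, forall x y, I x -> I y -> I (x + y) & forall a x, I x -> I (a * x)].

Definition sf_positive : set sf_alg :=
  smallest is_left_ideal
    [set x | exists (u : h) (n : int), (0 < n)%R /\ x = sf_gen u n].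

Lemma sf_positive_ideal : is_left_ideal sf_positive.
Proof.
split=> [I [[I0 _ _] _]|x y Ix Iy I HI|a x Ix I HI] //.
- by case: (HI) => -[_ ID _] _; apply: ID; [apply: Ix|apply: Iy].
- by case: (HI) => -[_ _ IM] _; apply: IM; apply: Ix.
Qed.

Lemma sf_positiveZ (a : k) x : sf_positive x -> sf_positive (a *: x).
Proof.
case: sf_positive_ideal => _ _ IM Ix.
by rewrite -[x]mul1r sf_scalerAl; apply: IM.
Qed.

Definition sf_positive_pred : {pred sf_alg} := fun x => `[< sf_positive x >].

Fact sf_positive_zmod : zmod_closed sf_positive_pred.
Proof.
case: sf_positive_ideal => I0 ID IM.
split=> [|x y /asboolP Ix /asboolP Iy]; apply/asboolP => //.
by apply: ID => //; rewrite -mulN1r; apply: IM.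
Qed.
HB.instance Definition _ :=
  GRing.isZmodClosed.Build sf_alg sf_positive_pred sf_positive_zmod.

Definition fock := Quotient.quot sf_positive_pred.
HB.instance Definition _ := GRing.Zmodule.on fock.

Definition sf_proj (x : sf_alg) : fock := \pi_(fock)%qT x.

Lemma sf_projP x y : sf_proj x = sf_proj y <-> sf_positive (x - y).
Proof.
rewrite /sf_proj; split.
- by move=> /eqP; rewrite -Quotient.idealrBE => /asboolP.
- by move=> xy; apply/eqP; rewrite -Quotient.idealrBE; apply/asboolP.
Qed.

Lemma sf_projD x y : sf_proj (x + y) = sf_proj x + sf_proj y.
Proof. exact: (@raddfD _ _ (\pi_(fock)%qT)). Qed.

Lemma sf_proj_repr (v : fock) : sf_proj (repr v) = v.
Proof. exact: reprK. Qed.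

Definition fock_scale (a : k) (v : fock) : fock := sf_proj (a *: repr v).

Lemma fock_scaleE a x : fock_scale a (sf_proj x) = sf_proj (a *: x).
Proof.
apply/sf_projP; rewrite -scalerBr; apply: sf_positiveZ.
by apply/sf_projP; rewrite sf_proj_repr.
Qed.

Fact fock_ind (P : fock -> Prop) : (forall x, P (sf_proj x)) -> forall v, P v.
Proof. by move=> Px v; rewrite -[v]sf_proj_repr; apply: Px. Qed.

Fact fock_scalerA a b v : fock_scale a (fock_scale b v) = fock_scale (a * b) v.
Proof. by elim/fock_ind: v => x; rewrite !fock_scaleE scalerA. Qed.
Fact fock_scale1r : left_id 1 fock_scale.
Proof. by elim/fock_ind => x; rewrite !fock_scaleE scale1r. Qed.
Fact fock_scalerDr : right_distributive fock_scale +%R.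
Proof.
move=> a; elim/fock_ind => x; elim/fock_ind => y.
by rewrite -sf_projD !fock_scaleE -sf_projD scalerDr.
Qed.
Fact fock_scalerDl v : {morph fock_scale^~ v : a b / a + b}.
Proof.
by move=> a b; elim/fock_ind: v => x; rewrite !fock_scaleE -sf_projD scalerDl.
Qed.
HB.instance Definition _ := GRing.Zmodule_isLmodule.Build k fock
  fock_scalerA fock_scale1r fock_scalerDr fock_scalerDl.

Lemma sf_proj_linear : linear sf_proj.
Proof. by move=> a x y; rewrite sf_projD -fock_scaleE. Qed.

Definition act (x : sf_alg) (v : fock) : fock := sf_proj (x * repr v).

Lemma actE x y : act x (sf_proj y) = sf_proj (x * y).
Proof.
apply/sf_projP; rewrite -mulrBr; case: sf_positive_ideal => _ _; apply.
by apply/sf_projP; rewrite sf_proj_repr.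
Qed.

Lemma act_linear x : linear (act x).
Proof.
move=> a; elim/fock_ind => y; elim/fock_ind => z.
by rewrite -sf_proj_linear !actE -sf_proj_linear mulrDr sf_scalerAr.
Qed.

Lemma actM x y v : act (x * y) v = act x (act y v).
Proof. by elim/fock_ind: v => z; rewrite !actE mulrA. Qed.

Definition vac : fock := sf_proj 1.

Definition fock_word (s : seq (h * nat)) : fock :=
  act (\prod_(p <- s) sf_gen p.1 (- p.2%:Z)) vac.

Definition fock_even : set fock :=
  span [set v | exists s, ~~ odd (size s) /\ v = fock_word s].

Definition fock_odd : set fock :=
  span [set v | exists s, odd (size s) /\ v = fock_word s].

Definition is_parity_operator (K : fock -> fock) :=
  [/\ linear K, forall v, fock_even v -> K v = v
    & forall v, fock_odd v -> K v = - v].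

Fixpoint sf_parity_expr (x : expr) : sf_alg :=
  match x with
  | EGen u n => - sf_gen u n
  | EZero => 0
  | EOne => 1
  | EAdd x y => sf_parity_expr x + sf_parity_expr y
  | EOpp x => - sf_parity_expr x
  | EMul x y => sf_parity_expr x * sf_parity_expr y
  | EScale a x => a *: sf_parity_expr x
  end.

Lemma sf_parity_expr_eq x y : sf_eq x y -> sf_parity_expr x = sf_parity_expr y.
Proof.
elim=> {x y} //=.
- by move=> x y z _ -> _ ->.
- by move=> x x' y y' _ -> _ ->.
- by move=> x x' _ ->.
- by move=> x x' y y' _ -> _ ->.
- by move=> a x x' _ ->.
- by move=> *; rewrite addrA.
- by move=> *; rewrite addrC.
- by move=> *; rewrite add0r.
- by move=> *; rewrite addNr.
- by move=> *; rewrite mulrA.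
- by move=> *; rewrite mul1r.
- by move=> *; rewrite mulr1.
- by move=> *; rewrite mulrDl.
- by move=> *; rewrite mulrDr.
- by move=> *; rewrite scalerA.
- by move=> *; rewrite scale1r.
- by move=> *; rewrite scalerDr.
- by move=> *; rewrite scalerDl.
- by move=> *; rewrite sf_scalerAl.
- by move=> *; rewrite sf_scalerAr.
- by move=> a u v n; rewrite sf_gen_linearP opprD scalerN.
- by move=> u v m n; rewrite !mulrNN sf_gen_commP.
Qed.

Definition sf_parity (x : sf_alg) : sf_alg := sf_parity_expr (repr x).
Fact sf_parityE x : sf_parity (A_ x) = sf_parity_expr x.
Proof. exact/sf_parity_expr_eq/sf_reprP. Qed.
Fact sf_parityD x y : sf_parity (x + y) = sf_parity x + sf_parity y.
Proof.
elim/sf_ind: x => x; elim/sf_ind: y => y.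
by rewrite [X in sf_parity X]/GRing.add /= sf_piE !sf_parityE.
Qed.
Fact sf_parityM x y : sf_parity (x * y) = sf_parity x * sf_parity y.
Proof.
elim/sf_ind: x => x; elim/sf_ind: y => y.
by rewrite [X in sf_parity X]/GRing.mul /= sf_piE !sf_parityE.
Qed.
Fact sf_parityZ a x : sf_parity (a *: x) = a *: sf_parity x.
Proof.
by elim/sf_ind: x => x; rewrite [X in sf_parity X]/GRing.scale /= sf_piE !sf_parityE.
Qed.
Fact sf_parity0 : sf_parity 0 = 0. Proof. exact: sf_parityE EZero. Qed.
Fact sf_parity1 : sf_parity 1 = 1. Proof. exact: sf_parityE EOne. Qed.
Fact sf_parityG u n : sf_parity (sf_gen u n) = - sf_gen u n.
Proof. exact: sf_parityE. Qed.

Fact sf_parity_pos x : sf_positive x -> sf_positive (sf_parity x).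
Proof.
case: sf_positive_ideal => I0 ID IM.
apply: (@smallest_sub _ is_left_ideal _ [set x | sf_positive (sf_parity x)]).
  split=> [|y z /= Iy Iz|a y /= Iy] /=; first by rewrite sf_parity0.
  - by rewrite sf_parityD; apply: ID.
  - by rewrite sf_parityM; apply: IM.
move=> _ [u [n [n0 ->]]] /=; rewrite sf_parityG -mulN1r; apply: IM.
by apply: sub_gen_smallest; exists u, n.
Qed.

Definition fock_parity (v : fock) : fock := sf_proj (sf_parity (repr v)).
Fact fock_parityE x : fock_parity (sf_proj x) = sf_proj (sf_parity x).
Proof.
apply/sf_projP; rewrite -scaleN1r -sf_parityZ -sf_parityD scaleN1r; apply: sf_parity_pos.
by apply/sf_projP; rewrite sf_proj_repr.
Qed.

Fact fock_parity_word s : fock_parity (fock_word s) = (-1) ^+ odd (size s) *: fock_word s.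
Proof.
rewrite /fock_word /vac !actE !mulr1 fock_parityE -[RHS]/(fock_scale _ _).
rewrite fock_scaleE; congr sf_proj.
elim: s => [|p s IH]; first by rewrite big_nil sf_parity1 expr0 scale1r.
rewrite big_cons sf_parityM IH sf_parityG /= -sf_scalerAr mulNr signrN.
by rewrite scalerN scaleNr.
Qed.

(* Hypotheses of the form [is_parity_operator K] are therefore not vacuous. *)
Lemma parity_operator_exists : exists K, is_parity_operator K.
Proof.
have Klin : linear fock_parity.
  move=> a; elim/fock_ind => x; elim/fock_ind => y.
  by rewrite -sf_proj_linear !fock_parityE -sf_proj_linear sf_parityD sf_parityZ.
have K0 : fock_parity 0 = 0.
  by have := Klin (-1) 0 0; rewrite scaleN1r addNr scaleN1r addNr.
exists fock_parity; split=> // v.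
- apply: (@smallest_sub _ is_subspace _ [set v | fock_parity v = v]).
    by split=> //= a x y /= Kx Ky; rewrite Klin Kx Ky.
  by move=> _ [s [/negbTE os ->]] /=; rewrite fock_parity_word os scale1r.
- apply: (@smallest_sub _ is_subspace _ [set v | fock_parity v = - v]).
    split=> [|a x y /= Kx Ky] /=; first by rewrite K0 oppr0.
    by rewrite Klin Kx Ky scalerN opprD.
  by move=> _ [s [os ->]] /=; rewrite fock_parity_word os expr1 scaleN1r.
Qed.

End Presentation.

Section ZeroModes.
Context {k : fieldType} {h : lmodType k} {form : h -> h -> k} {d : nat}.
Variables (phi psi : 'I_d -> h) (K : fock form -> fock form).

Definition op_e (i : 'I_d) : fock form -> fock form := act (sf_gen form (phi i) 0).
Definition op_f (i : 'I_d) : fock form -> fock form := act (sf_gen form (psi i) 0).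

Definition P_alg : set (fock form -> fock form) :=
  generated_algebra (range op_e `|` range op_f `|` [set K]).

(* The exponents m i, n i, l in {0,1} are booleans; iterating a composition
   over i < d puts the factor of index 0 on the left. *)
Definition monomial (m n : 'I_d -> bool) : fock form -> fock form :=
  \big[comp/id]_(i < d) (iter (m i) (op_e i) \o iter (n i) (op_f i)).

Definition Omega : set (fock form -> fock form) :=
  [set g | exists (m n : 'I_d -> bool) (l : bool), g = monomial m n \o iter l K].

Definition ZOmega : set (fock form -> fock form) :=
  [set g | exists m n : 'I_d -> bool,
     ~~ odd (\sum_(i < d) (m i + n i))%N /\ g = monomial m n]
  `|` [set (\big[comp/id]_(i < d) (op_e i \o op_f i)) \o K].

End ZeroModes.

(* Main.v *)
From HB Require Import structures.
Require Import Defs.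
From mathcomp Require Import all_boot all_order all_algebra.
From mathcomp Require Import boolp classical_sets functions cardinality.
From mathcomp Require Import reals complex.

(** Write [t j] for the [n = 2d] zero modes e_1, f_1, e_2, f_2, and so on.  The
anticommutation relation for two modes of index 0 has a vanishing right-hand
side, so the [t j] anticommute and square to zero, and [K] is an involution
anticommuting with each of them.  Hence [P] is a quotient of the algebra with
the 2^(n+1) monomials t_S K^l, for S a set of indices and l in {0, 1}.

Independence ([signed_mono_coef]).  In a vanishing combination of the t_S K^l
take S minimal with a nonzero coefficient and multiply on the left by the
product of the t_j with j outside S: every other term acquires a repeated
factor and dies, and what remains is t_top (a + b K) = 0.  Evaluated on an even
and on an odd vector not killed by t_top this says a + b = 0 and a - b = 0.
The vacuum is a suitable even vector, and h_{-1} applied to the vacuum, with h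
a basis vector, a suitable odd one.

The two nonvanishing facts concern the Fock space, which is a quotient of an
algebra given by generators and relations.  They follow from a concrete
representation ([rep]) by creation and annihilation operators on the functions
on configurations of occupied sites, in which the positive modes kill the empty
state and distinct creation operators produce a visible nonzero value
([basis_word_neq0]).

Center.  Let z be the sum of the c(S, l) t_S K^l.  Commuting with K forces
c(S, l) = 0 for |S| odd.  For |S| even, t_S K^l t_j = (-1)^l t_j t_S K^l, so
commuting with t_j gives 2 t_j (sum over S of c(S, 1) t_S K) = 0, and the
argument above applied to this relation gives c(S, 1) = 0 for all S not
containing j.  So only S = top survives with l = 1, and the listed monomials are
central by the same sign rules, n being even.  Finally, half of the 2^n sets S
are even, because toggling one element changes the parity.

That [K] satisfies these relations on the whole Fock space uses that the words in
nonpositive modes span it ([fock_words_span]), since [K] is only prescribed on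
such words. *)

Set Implicit Arguments.
Unset Strict Implicit.
Unset Printing Implicit Defensive.

Import Order.TTheory GRing.Theory Num.Theory.
Local Open Scope ring_scope.
Local Open Scope classical_set_scope.

Local Notation span := Defs.span.

(** * Spans, free families and generated algebras *)

Section Span.
Context {k : fieldType} {V : lmodType k}.
Implicit Types (B : set V) (u v : V).

Lemma span_subspace B : is_subspace (span B).
Proof.
split=> [S [[S0 _] _]|a u v Bu Bv S BS]; first exact: S0.
by case: (BS) => -[_ SD] _; apply: SD; [apply: Bu | apply: Bv].
Qed.

Lemma mem_span B v : B v -> span B v.
Proof. exact: (@sub_gen_smallest _ is_subspace). Qed.

Lemma span_min B S : is_subspace S -> B `<=` S -> span B `<=` S.
Proof. exact: smallest_sub. Qed.

Lemma span0 B : span B 0.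
Proof. by case: (span_subspace B). Qed.

Lemma spanZ B a v : span B v -> span B (a *: v).
Proof.
have [B0 BD] := span_subspace B.
by move=> Bv; rewrite -[_ *: _]addr0; apply: BD.
Qed.

Lemma span_sum B (I : Type) (r : seq I) (P : pred I) (F : I -> V) :
  (forall i, P i -> span B (F i)) -> span B (\sum_(i <- r | P i) F i).
Proof.
move=> BF; apply: big_ind => //; first exact: span0.
have [_ BD] := span_subspace B.
by move=> u v Bu Bv; rewrite -[u]scale1r; apply: BD.
Qed.

Lemma sub_lin_indep B B' : B `<=` B' -> lin_indep B' -> lin_indep B.
Proof. by move=> BB' iB' s c us sB; apply: iB' => // v /sB/BB'. Qed.

Context {I : finType}.
Implicit Type x : I -> V.

Definition free_family x :=
  forall c : I -> k, \sum_i c i *: x i = 0 -> forall i, c i = 0.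

Lemma free_family_inj x : free_family x -> injective x.
Proof.
move=> fx i j xij; apply/eqP/negPn/negP => nij.
pose c l : k := (l == i)%:R - (l == j)%:R.
have sum0 : \sum_l c l *: x l = 0.
  rewrite (bigD1 i) // (bigD1 j) 1?eq_sym //= /c !eqxx (negbTE nij) eq_sym.
  rewrite (negbTE nij) xij subr0 sub0r scaleN1r scale1r big1 ?addr0 ?subrr //.
  by move=> l /andP[/negbTE -> /negbTE ->]; rewrite subr0 scale0r.
by have /eqP := fx c sum0 i; rewrite /c eqxx (negbTE nij) subr0 oner_eq0.
Qed.

(** Pulls a combination over a duplicate-free list of vectors back to the index
type; this lets everything below be stated with sums over a finite type. *)
Lemma free_family_indep x : free_family x -> lin_indep (range x).
Proof.
move=> fx s c us sx sum0 v vs.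
have /cid2[/= r _ rE] : exists2 r : seq I, True & s = map x r.
  elim: s sx {us sum0 vs} => [|u s IH] sx; first by exists [::].
  have /= [i _ xi] := sx u (mem_head _ _).
  have [w ws|r _ ->] := IH; first by apply: sx; rewrite /= inE ws orbT.
  by exists (i :: r); rewrite //= xi.
move: us sum0 vs; rewrite rE => us; rewrite big_map => sum0 /mapP[i ir ->].
have ur := map_uniq us.
pose c' j := if j \in r then c (x j) else 0.
suff /fx/(_ i) : \sum_j c' j *: x j = 0 by rewrite /c' ir.
apply: etrans sum0; rewrite [RHS]big_uniq //= [RHS]big_mkcond; apply: eq_bigr => j _.
by rewrite /c'; case: ifP => // _; rewrite scale0r.
Qed.

Lemma span_rangeP x v :
  span (range x) v -> exists c : I -> k, v = \sum_i c i *: x i.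
Proof.
apply: (@span_min _ [set v | exists c : I -> k, v = \sum_i c i *: x i]).
  split=> [|a _ _ [c ->] [c' ->]].
    by exists (fun=> 0); rewrite big1 // => i _; rewrite scale0r.
  exists (fun i => a * c i + c' i); rewrite scaler_sumr -big_split /=.
  by apply: eq_bigr => i _; rewrite scalerDl scalerA.
move=> _ [i _ <-]; exists (fun j => (j == i)%:R).
rewrite (bigD1 i) //= eqxx scale1r big1 ?addr0 // => j /negbTE ->.
by rewrite scale0r.
Qed.

End Span.

Section GeneratedAlgebra.
Context {k : fieldType} {V : lmodType k}.
Implicit Types (G S : set (V -> V)) (f g z : V -> V).

Lemma linear_ops_subspace : is_subspace (@linear_ops k V).
Proof.
split=> [a u v|b f g Lf Lg a u v]; first by rewrite /= scaler0 addr0.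
rewrite !fctE Lf Lg !scalerDr !scalerA [a * b]mulrC !addrA; congr (_ + _).
by rewrite -!addrA; congr (_ + _); rewrite addrC.
Qed.

Lemma generated_algebra_subalgebra G :
  G `<=` linear_ops -> is_subalgebra (generated_algebra G).
Proof.
move=> GL; split.
- apply: smallest_sub => //; split=> //; first exact: linear_ops_subspace.
  by move=> f g Lf Lg a u v; rewrite /= Lg Lf.
- split=> [S [[_ [S0 _] _ _] _]|a f g Gf Gg S SG] //.
  by case: (SG) => -[_ [_ SD] _ _] _; apply: SD; [apply: Gf | apply: Gg].
- by move=> S [[]].
- move=> f g Gf Gg S SG.
  by case: (SG) => -[_ _ _ SM] _; apply: SM; [apply: Gf | apply: Gg].
Qed.

Lemma linear_ops0 f : linear_ops f -> f 0 = 0.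
Proof. by move=> Lf; have := Lf (-1) 0 0; rewrite scaleN1r addNr scaleN1r addNr. Qed.

Lemma center_subspace G :
  G `<=` linear_ops -> is_subspace (center (generated_algebra G)).
Proof.
move=> /generated_algebra_subalgebra[PL [P0 PD] P1 PM].
split=> [|a z1 z2 [Pz1 z1C] [Pz2 z2C]].
  by split=> // f /PL/linear_ops0 f0; apply/funext => v /=.
split=> [|f Pf]; first exact: PD.
have Lf := PL _ Pf; apply/funext => v /=; rewrite !fctE Lf.
have /= -> := congr1 (fun g => g v) (z1C _ Pf).
by have /= -> := congr1 (fun g => g v) (z2C _ Pf).
Qed.

(** The elements commuting with [z] form a subalgebra, so commutation need only
be tested on generators. *)
Lemma generated_center G z : G `<=` linear_ops ->
  generated_algebra G z -> (forall f, G f -> z \o f = f \o z) ->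
  center (generated_algebra G) z.
Proof.
move=> GL Gz zG; split=> // f Gf.
have [PL [P0 PD] P1 PM] := generated_algebra_subalgebra GL.
have Lz := PL _ Gz.
have z0 := linear_ops0 Lz.
suff : [set f | generated_algebra G f /\ z \o f = f \o z] f by case.
move: f Gf; apply: smallest_sub; last first.
  by move=> f Gf; split; [apply: sub_gen_smallest | apply: zG].
split.
- by move=> f [/PL].
- split=> [|a f g [Pf zf] [Pg zg]]; first by split=> //; apply/funext => v /=.
  split; first exact: PD.
  apply/funext => v /=; rewrite !fctE Lz.
  by rewrite -[z (f v)]/((z \o f) v) -[z (g v)]/((z \o g) v) zf zg.
- by [].
- move=> f g [Pf zf] [Pg zg]; split; first exact: PM.
  by rewrite compA zf -compA zg compA.
Qed.

End GeneratedAlgebra.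

(** * Anticommuting operators and an involution *)

Section Word.
Context {k : fieldType} {V : lmodType k} {J : eqType}.
Variable t : J -> {linear V -> V}.
Implicit Type s : seq J.

Fixpoint word s (v : V) : V := if s is j :: s' then t j (word s' v) else v.

Lemma word_linear s : linear (word s).
Proof. by elim: s => //= j s IH a u v; rewrite IH linearP. Qed.
HB.instance Definition _ s := GRing.isLinear.Build k V V _ (word s) (word_linear s).

Lemma word_cat s1 s2 v : word (s1 ++ s2) v = word s1 (word s2 v).
Proof. by elim: s1 => //= j s1 ->. Qed.

Hypothesis t_anti : forall i j v, t i (t j v) = - t j (t i v).
Hypothesis char_neq2 : (2%:R : k) != 0.

Lemma anti_sqr0 j v : t j (t j v) = 0.
Proof.
have /eqP : 2%:R *: t j (t j v) = 0.
  by rewrite scaler_nat mulr2n {1}t_anti addNr.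
by rewrite scaler_eq0 (negbTE char_neq2) => /eqP.
Qed.

(** The case j in s is consistent: both sides then vanish. *)
Lemma word_swap s j v : word s (t j v) = (-1) ^+ size s *: t j (word s v).
Proof.
elim: s => [|i s IH] /=; first by rewrite scale1r.
by rewrite IH linearZ /= t_anti exprS scalerN mulN1r scaleNr.
Qed.

Lemma word_not_uniq s v : ~~ uniq s -> word s v = 0.
Proof.
elim: s => //= j s IH; rewrite negb_and negbK => /orP[/splitPr[s1 s2]|/IH ->].
  by rewrite word_cat /= word_swap linearZ /= anti_sqr0 scaler0.
exact: linear0.
Qed.

(** The sign is that of the permutation, of which only the existence matters. *)
Lemma word_perm s s' : perm_eq s s' ->
  exists b : bool, forall v, word s v = (-1) ^+ b *: word s' v.
Proof.
elim: s s' => [|j s IH] s'.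
  by rewrite perm_sym => /perm_nilP ->; exists false => v; rewrite scale1r.
move=> ss'; have js' : j \in s' by rewrite -(perm_mem ss') mem_head.
case/splitPr: js' ss' => s1 s2 ss'.
have /IH[b sE] : perm_eq s (s1 ++ s2).
  by rewrite -(perm_cons j) (perm_trans ss') // perm_catC /= perm_cons perm_catC.
exists (odd (size s1) (+) b) => v; rewrite /= sE !word_cat linearZ /= word_swap.
by rewrite signr_addb signr_odd !scalerA mulrAC -expr2 sqrr_sign mul1r.
Qed.

End Word.

Section Involution.
Context {k : fieldType} {V : lmodType k} {J : finType}.
Variables (t : J -> {linear V -> V}) (K : {linear V -> V}).
Hypothesis char_neq2 : (2%:R : k) != 0.
Hypothesis t_anti : forall i j v, t i (t j v) = - t j (t i v).
Hypothesis KK : forall v, K (K v) = v.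
Hypothesis Kt : forall j v, K (t j v) = - t j (K v).

Let G : set (V -> V) := range (fun j => t j : V -> V) `|` [set (K : V -> V)].

Lemma involution_word s v : K (word t s v) = (-1) ^+ size s *: word t s (K v).
Proof.
elim: s => [|j s IH] /=; first by rewrite scale1r.
by rewrite Kt IH linearZ /= exprS mulN1r scaleNr.
Qed.

(** [enum] lists a set in a fixed order, so this is the ordered monomial indexed
by a set of generators, times a power of the involution. *)
Definition signed_mono (i : {set J} * bool) : V -> V :=
  word t (enum i.1) \o iter i.2 K.

Lemma signed_mono_linear i : linear (signed_mono i).
Proof.
by case: i => S [] a u v; rewrite /signed_mono /= ?linearP //= linearP.
Qed.
HB.instance Definition _ i :=
  GRing.isLinear.Build k V V _ (signed_mono i) (signed_mono_linear i).

Lemma signed_mono_t i j v :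
  signed_mono i (t j v) = (-1) ^+ (odd #|i.1| (+) i.2) *: t j (signed_mono i v).
Proof.
case: i => S l; rewrite signr_addb /signed_mono /=; case: l => /=.
  by rewrite Kt linearN /= word_swap // -cardE -(signr_odd _ #|S|) mulrN1 scaleNr.
by rewrite word_swap // -cardE -(signr_odd _ #|S|) mulr1.
Qed.

Lemma signed_mono_K i v :
  signed_mono i (K v) = (-1) ^+ odd #|i.1| *: K (signed_mono i v).
Proof.
have sgn2 (b : bool) u : (-1) ^+ b *: ((-1) ^+ b *: u) = u :> V.
  by rewrite scalerA -expr2 sqrr_sign scale1r.
case: i => S [] /=; rewrite /signed_mono /= involution_word -cardE;
  by rewrite -(signr_odd _ #|S|) sgn2.
Qed.

(** By the sign rules a product of two monomials is zero, when the index sets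
meet, or plus or minus the monomial of the union. *)
Lemma span_signed_mono_comp (f g : V -> V) : span (range signed_mono) f ->
  span (range signed_mono) g -> span (range signed_mono) (f \o g).
Proof.
move=> Sf Sg; have [_ SD] := span_subspace (range signed_mono).
suff : span (range signed_mono) `<=`
    [set f : V -> V | span (range signed_mono) (f \o g)].
  exact.
apply: span_min.
  split=> [|a f1 f2 Sf1 Sf2]; first exact: span0.
  exact: SD.
move=> _ [[S l] _ <-] /=.
suff : span (range signed_mono) `<=`
    [set g : V -> V | span (range signed_mono) (signed_mono (S, l) \o g)].
  exact.
apply: span_min.
  split=> [|a g1 g2 Sg1 Sg2] /=.
    by rewrite (_ : _ \o _ = 0); [exact: span0 | apply/funext => v; exact: linear0].
  rewrite (_ : _ \o _ = a *: (signed_mono (S, l) \o g1) + (signed_mono (S, l) \o g2)).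
    exact: SD.
  by apply/funext => v; rewrite /= linearP.
move=> _ [[T l'] _ <-] /=.
have [b KlE] : exists b : bool, forall v,
    iter l K (word t (enum T) v) = (-1) ^+ b *: word t (enum T) (iter l K v).
  exists (l && odd #|T|) => v; case: l => /=; last by rewrite scale1r.
  by rewrite involution_word -cardE signr_odd.
have KllE v : iter l K (iter l' K v) = iter (l (+) l') K v.
  by case: l l' {b KlE} => [] [] /=.
have [uST|nST] := boolP (uniq (enum S ++ enum T)); last first.
  rewrite (_ : _ \o _ = 0); first exact: span0.
  apply/funext => v; rewrite /signed_mono /= KlE linearZ /= -word_cat.
  by rewrite word_not_uniq // scaler0.
have /(word_perm t_anti)[c stE] : perm_eq (enum S ++ enum T) (enum (S :|: T)).
  apply: uniq_perm => //; first exact: enum_uniq.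
  by move=> j; rewrite mem_cat !mem_enum inE.
rewrite (_ : _ \o _ = ((-1) ^+ b * (-1) ^+ c) *: signed_mono (S :|: T, l (+) l')).
  by apply: spanZ; apply: mem_span; exists (S :|: T, l (+) l').
apply/funext => v; rewrite /signed_mono /= KlE linearZ /= -word_cat stE KllE.
by rewrite scalerA.
Qed.

Lemma generators_linear : G `<=` linear_ops.
Proof. by move=> f [[j _ <-]|->] a u v; rewrite linearP. Qed.

Lemma span_signed_mono : span (range signed_mono) = generated_algebra G.
Proof.
have [PL Psub P1 PM] := generated_algebra_subalgebra generators_linear.
have Pt j : generated_algebra G (t j) by apply: sub_gen_smallest; left; exists j.
have PK : generated_algebra G K by apply: sub_gen_smallest; right.
apply/seteqP; split.
  apply: span_min => // _ [[S l] _ <-]; apply: (PM); last by case: l.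
  by elim: (enum S) => //= j s IH; apply: PM.
apply: smallest_sub.
  split.
  - apply: span_min; first exact: linear_ops_subspace.
    by move=> _ [i _ <-]; apply: signed_mono_linear.
  - exact: span_subspace.
  - apply: mem_span; exists (finset.set0, false) => //; rewrite /signed_mono /=.
    by rewrite enum_set0.
  - exact: span_signed_mono_comp.
move=> _ [[j _ <-]|->]; apply: mem_span.
  by exists ([set j]%SET, false) => //; rewrite /signed_mono /= enum_set1.
by exists (finset.set0, true) => //; rewrite /signed_mono /= enum_set0.
Qed.

Variables vp vm : V.
Hypothesis Kvp : K vp = vp.
Hypothesis Kvm : K vm = - vm.
Hypothesis top_vp : word t (enum J) vp != 0.
Hypothesis top_vm : word t (enum J) vm != 0.

(** Multiplying on the left by the generators outside both S and [w] turns the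
term of S into the top monomial and kills the others, by induction on |S|.
Besides freeness ([w] empty) this covers relations [t j (...) = 0], from which
the center is computed. *)
Lemma signed_mono_coef (w : seq J) (c : {set J} * bool -> k) : uniq w ->
  (forall v, word t w (\sum_i c i *: signed_mono i v) = 0) ->
  forall (S : {set J}) l, {in S, forall j, j \notin w} -> c (S, l) = 0.
Proof.
move=> uw sum0 S; have [n] := ubnP #|S|; elim: n S => // n IH S Sn l Sw.
pose y := enum (~: (S :|: [set j in w])).
have yE j : (j \in y) = (j \notin S) && (j \notin w).
  by rewrite mem_enum !inE negb_or.
have /(word_perm t_anti)[b topE] : perm_eq (y ++ w ++ enum S) (enum J).
  apply: uniq_perm; rewrite ?enum_uniq //.
    rewrite !cat_uniq !enum_uniq uw /= andbT; apply/andP; split; apply/hasPn => j.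
      by rewrite mem_cat mem_enum yE => /orP[->|->]; rewrite ?andbF.
    by rewrite mem_enum; apply: Sw.
  move=> j; rewrite !mem_cat yE !mem_enum !inE.
  by case: (j \in S); case: (j \in w).
have nTF : (S, true) != (S, false) by rewrite xpair_eqE andbF.
have topSum v : c (S, false) *: word t (enum J) v
              + c (S, true) *: word t (enum J) (K v) = 0.
  have := congr1 (word t y) (sum0 v); rewrite linear0 -word_cat linear_sum /=.
  (* The other index sets vanish: T meets w, or T is smaller than S and the
     induction hypothesis applies, or T has an element outside S, hence in y. *)
  rewrite (bigD1 (S, false)) //= (bigD1 (S, true)) //= big1 ?addr0; last first.
    case=> T l' /andP[nF nT].
    have nTS : T != S.
      by apply: contraNneq nT => TS; case: l' nF; rewrite TS ?eqxx.
    rewrite linearZ /= /signed_mono /= -word_cat -catA.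
    have [/hasP[j jT jw]|nTw] := boolP (has (mem w) (enum T)).
      rewrite word_not_uniq ?scaler0 // !cat_uniq !negb_and !negbK.
      by apply/orP; right; apply/orP; right; rewrite orbA; apply/orP; left;
         apply/orP; right; apply/hasP; exists j.
    have [TS|ST] := ltnP #|T| #|S|.
      rewrite IH ?scale0r ?(leq_trans TS) // => j jT.
      by move/hasPn: nTw; apply; rewrite mem_enum.
    have /subsetPn[j jT jS] : ~~ (T \subset S).
      by apply: contra nTS => sTS; rewrite eqEcard sTS.
    rewrite word_not_uniq ?scaler0 // cat_uniq !negb_and !negbK.
    apply/orP; right; apply/orP; left; apply/hasP; exists j.
      by rewrite mem_cat mem_enum jT orbT.
    by rewrite yE jS; move/hasPn: nTw; apply; rewrite mem_enum.
  rewrite !linearZ /= /signed_mono /= -!word_cat -catA !topE !scalerA.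
  rewrite ![_ * (-1) ^+ b]mulrC -!scalerA -scalerDr => /eqP.
  by rewrite scaler_eq0 signr_eq0 => /eqP.
have cp : c (S, false) + c (S, true) = 0.
  apply/eqP; move/eqP: (topSum vp); rewrite Kvp -scalerDl scaler_eq0.
  by rewrite (negbTE top_vp) orbF.
have cm : c (S, false) - c (S, true) = 0.
  apply/eqP; move/eqP: (topSum vm); rewrite Kvm linearN /= scalerN -scalerBl.
  by rewrite scaler_eq0 (negbTE top_vm) orbF.
have cFT : c (S, false) = c (S, true) by apply/eqP; rewrite -subr_eq0 cm.
have cT : c (S, true) = 0.
  apply/eqP; move/eqP: cp; rewrite cFT -mulr2n -mulr_natl mulf_eq0.
  by rewrite (negbTE char_neq2).
by case: l; rewrite ?cFT cT.
Qed.

Lemma signed_mono_free : free_family signed_mono.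
Proof.
move=> c sum0 [S l]; apply: (@signed_mono_coef [::]) => // v.
rewrite -[RHS]/((0 : V -> V) v) -sum0 fct_sumE.
by apply: eq_bigr.
Qed.

Lemma signed_mono_basis : is_basis (range signed_mono) (generated_algebra G).
Proof.
by split; [apply/free_family_indep/signed_mono_free | apply: span_signed_mono].
Qed.

Definition central_index : {set {set J} * bool} :=
  [set i | if i.2 then i.1 == [set: J]%SET else ~~ odd #|i.1|].

(** Evenness of [#|J|] makes the top monomial commute with [K]; it is what puts
the top monomial times [K] in the center. *)
Lemma signed_mono_center_basis : ~~ odd #|J| ->
  is_basis (signed_mono @` [set` central_index]) (center (generated_algebra G)).
Proof.
move=> evJ; split.
  apply: sub_lin_indep (free_family_indep signed_mono_free).
  by move=> _ [i _ <-]; exists i.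
have [PL Psub P1 PM] := generated_algebra_subalgebra generators_linear.
apply/seteqP; split.
  apply: span_min => [|_ [i iZ <-]]; first exact: center_subspace generators_linear.
  apply: generated_center; first exact: generators_linear.
    by rewrite -span_signed_mono; apply: mem_span; exists i.
  move: iZ; case: i => S l; rewrite /= inE /= => iZ.
  have evS : odd #|S| = false.
    apply/negbTE; case: l iZ => // /eqP ->; by rewrite cardsT.
  move=> _ [[j _ <-]|->]; apply/funext => v /=; last first.
    by rewrite signed_mono_K /= evS scale1r.
  rewrite signed_mono_t /= evS addFb; case: l iZ => [/eqP ->|_]; last first.
    by rewrite scale1r.
  rewrite /signed_mono /= -[t j _]/(word t (j :: _) _) word_not_uniq ?scaler0 //.
  by rewrite /= mem_enum inE.
move=> z [Pz zC]; move: Pz; rewrite -span_signed_mono => /span_rangeP[c zE].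
have zv v : z v = \sum_i c i *: signed_mono i v.
  by rewrite zE fct_sumE.
have PK : generated_algebra G K by apply: sub_gen_smallest; right.
have Pt j : generated_algebra G (t j) by apply: sub_gen_smallest; left; exists j.
have two_neq0 (a : k) : a * (1 - -1) = 0 -> a = 0.
  move=> /eqP; rewrite opprK mulf_eq0 -[1 + 1]/(2%:R : k) (negbTE char_neq2) orbF.
  by move/eqP.
(* Commuting with K kills the monomials of odd length. *)
have c_odd (S : {set J}) l : odd #|S| -> c (S, l) = 0.
  move=> oS; apply: two_neq0.
  have := @signed_mono_coef [::] (fun i => c i * (1 - (-1) ^+ odd #|i.1|)) isT.
  move=> /(_ _ S l) /=; rewrite oS expr1; apply=> // v.
  have := congr1 (fun f => f (K v)) (zC _ PK); rewrite /= KK => zKv.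
  apply/eqP; move: zKv; rewrite !zv linear_sum /= => /eqP.
  rewrite -subr_eq0 -sumrB; congr (_ == _); apply: eq_bigr => i _.
  rewrite linearZ /= signed_mono_K [K (_ *: _)]linearZ /= KK -scalerA -scalerBr.
  by rewrite scalerBl scale1r.
(* Commuting with t j, for some j outside S, kills the monomial of S times K. *)
have c_true (S : {set J}) : S != [set: J]%SET -> c (S, true) = 0.
  move=> nST; have [/c_odd ->//|evS] := boolP (odd #|S|).
  have /existsP[j jS] : [exists j, j \notin S].
    rewrite -negb_forall; apply: contra nST => /forallP SJ.
    by apply/eqP/setP => j; rewrite SJ inE.
  apply: two_neq0.
  have := @signed_mono_coef [:: j]
    (fun i => c i * (1 - (-1) ^+ (odd #|i.1| (+) i.2))) isT.
  move=> /(_ _ S true) /=; rewrite (negbTE evS) expr1; apply=> [v|i iS]; last first.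
    by rewrite inE; apply: contraNneq jS => <-.
  apply/eqP; move: (congr1 (fun f => f v) (zC _ (Pt j))).
  rewrite /= !zv !linear_sum /= => /esym/eqP.
  rewrite -subr_eq0 -sumrB; congr (_ == _); apply: eq_bigr => i _.
  rewrite ![t j (_ *: _)]linearZ /= signed_mono_t -!scalerA -scalerBr; congr (_ *: _).
  by rewrite scalerBl scale1r.
rewrite zE; apply: span_sum => i _.
have [iZ|] := boolP (i \in central_index).
  by apply: spanZ; apply: mem_span; exists i.
case: i => S [] /=; rewrite inE /=.
  by move=> nS; rewrite c_true // scale0r; apply: span0.
by rewrite negbK => oS; rewrite c_odd // scale0r; apply: span0.
Qed.

End Involution.

(** * Creation and annihilation operators on occupation configurations *)

Section OccupationModel.
Context {k : fieldType}.
Local Notation occ := (nat -> bool).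
Local Notation states := (occ -> k^o).
Implicit Types (S : occ) (F : states).

Definition flip m S : occ := fun i => (i == m) (+) S i.

(** The exponent of the Jordan-Wigner sign. *)
Fixpoint parity m S : bool := if m is m'.+1 then parity m' S (+) S m' else false.

Lemma flipK m : involutive (flip m).
Proof. by move=> S; apply/funext => i; rewrite /flip addbA addbb. Qed.

Lemma flipC m m' S : flip m (flip m' S) = flip m' (flip m S).
Proof. by apply/funext => i; rewrite /flip addbCA. Qed.

Lemma parity_flip m p S : parity m (flip p S) = (p < m)%N (+) parity m S.
Proof.
elim: m => //= m ->; rewrite /flip ltnS [m == p]eq_sym.
by case: (ltngtP p m) => _; case: (parity m S); case: (S m).
Qed.

(** The creation operator at site [m] when [b], the annihilation operator
otherwise.  All functions on configurations are allowed, not only finitely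
supported ones on finite configurations: each operator only looks at the sites
up to [m]. *)
Definition mode (b : bool) m F : states :=
  fun S => if S m == b then (-1) ^+ parity m S * F (flip m S) else 0.

Lemma mode_linear b m : linear (mode b m).
Proof.
move=> a F G; apply/funext => S; rewrite !fctE /mode.
case: eqP => _; last by rewrite scaler0 addr0.
by rewrite mulrDr -[a *: F _]/(a * F _) mulrCA.
Qed.
HB.instance Definition _ b m :=
  GRing.isLinear.Build k states states _ (mode b m) (mode_linear b m).

Lemma mode_anticomm b m b' m' F :
  mode b m (mode b' m' F) + mode b' m' (mode b m F)
  = ((m == m') && (b != b'))%:R *: F.
Proof.
apply/funext => S; rewrite !fctE /mode -[RHS]/(_ * F S).
have [<-|nm] /= := eqVneq m m'.
  rewrite /flip eqxx /= -/(flip m S) -/(flip m (flip m S)) flipK.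
  rewrite !parity_flip ltnn /=.
  by case: (S m); case: b; case: b' => /=;
     rewrite ?mulr0 ?addr0 ?add0r ?mul0r ?mul1r // mulrA -expr2 sqrr_sign mul1r.
have fm : flip m S m' = S m' by rewrite /flip eq_sym (negbTE nm).
have fm' : flip m' S m = S m by rewrite /flip (negbTE nm).
rewrite fm fm' mul0r; case: eqP => _; case: eqP => _; rewrite ?mulr0 ?addr0 //.
rewrite (flipC m m') !mulrA -mulrDl !parity_flip !signr_addb.
have -> : (m < m')%N = ~~ (m' < m)%N by rewrite -leqNgt ltn_neqAle nm.
by rewrite signrN; case: (_ < _)%N; case: (parity m S); case: (parity m' S);
   rewrite /= !(expr0, expr1, mulr1, mulrN1, mul1r, mulN1r, opprK) ?(addNr, addrN) ?mul0r.
Qed.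

Definition empty_state : states := fun S => `[< S = (fun=> false) >]%:R.

Lemma mode_empty m : mode false m empty_state = 0.
Proof.
apply/funext => S; rewrite /mode; case: eqP => // Sm.
rewrite /empty_state asboolF ?mulr0 // => /(congr1 (fun f => f m)).
by rewrite /flip eqxx Sm.
Qed.

(** The value at the configuration occupied exactly on [s] is a sign. *)
Lemma modes_neq0 (s : seq nat) : uniq s ->
  foldr (mode true) empty_state s (fun i => i \in s) != 0.
Proof.
elim: s => [|m s IH] /=; first by rewrite /empty_state asboolT ?oner_eq0.
move=> /andP[ms us]; rewrite /mode mem_head eqxx mulf_eq0 signr_eq0 /=.
suff -> : flip m (fun i => i \in m :: s) = (fun i => i \in s) by apply: IH.
apply/funext => i; rewrite /flip inE; case: eqP => //= ->.
by rewrite (negbTE ms).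
Qed.

End OccupationModel.

(** * A representation of the mode algebra, and nonvanishing in the Fock space *)

Section FockRepresentation.
Context {k : fieldType} {h : lmodType k} {J : finType}.
Variables (form : h -> h -> k) (b : J -> h) (xi : J -> h -> k).
Hypothesis form_l : forall v, scalar (form^~ v).
Hypothesis form_sk : forall u v, form u v = - form v u.
Hypothesis xi_scalar : forall j, scalar (xi j).
Hypothesis xi_b : forall i j, xi i (b j) = (i == j)%:R.
Hypothesis form_xi : forall u v, form u v = \sum_j form u (b j) * xi j v.
Local Notation states := ((nat -> bool) -> k^o).
Implicit Types (u v : h) (n m : int) (x y : sf_expr k h) (F : states).

(** A nonpositive mode creates the coordinates of [u] in the basis, a positive
mode [n] contracts with [n * form u]; since creation pairs with annihilation at
the same site, this gives back the factor [m * form u v] of the relations. *)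
Definition gen_coef u n (j : J) : k :=
  if n <= 0 then xi j u else n%:~R * form u (b j).

Definition gen_mode n (j : J) : states -> states := mode (n <= 0) (pickle (j, `|n|%N)).
HB.instance Definition _ n j := GRing.Linear.on (gen_mode n j).

Fixpoint rep x : states -> states :=
  match x with
  | EGen u n => fun F => \sum_j gen_coef u n j *: gen_mode n j F
  | EZero => fun=> 0
  | EOne => id
  | EAdd x y => fun F => rep x F + rep y F
  | EOpp x => fun F => - rep x F
  | EMul x y => rep x \o rep y
  | EScale a x => fun F => a *: rep x F
  end.

Lemma rep_linear x : linear (rep x).
Proof.
elim: x => [u n||||||] //=.
- move=> a F G; rewrite scaler_sumr -big_split; apply: eq_bigr => j _ /=.
  by rewrite linearP scalerDr !scalerA mulrC.
- by move=> a F G; rewrite scaler0 addr0.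
- by move=> x IHx y IHy a F G; rewrite IHx IHy scalerDr addrACA.
- by move=> x IHx a F G; rewrite IHx opprD scalerN.
- by move=> x IHx y IHy a F G; rewrite /= IHy IHx.
- by move=> c x IHx a F G; rewrite IHx scalerDr !scalerA mulrC.
Qed.
HB.instance Definition _ x :=
  GRing.isLinear.Build k states states _ (rep x) (rep_linear x).

(** Creation and annihilation at equal absolute index are opposite modes, except
that index 0 only creates. *)
Lemma gen_mode_anticomm m i n j F :
  gen_mode m i (gen_mode n j F) + gen_mode n j (gen_mode m i F)
  = (i == j)%:R *: (((m != 0) && (m + n == 0))%:R *: F).
Proof.
rewrite mode_anticomm scalerA -natrM mulnb (inj_eq (pcan_inj pickleK)) xpair_eqE.
rewrite -andbA; congr ((_ && _)%:R *: _).
by case: m n => [[|m]|m] [[|n]|n] //=; rewrite ?andbF ?andbT //;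
   rewrite ?NegzE -?opprD ?oppr_eq0 ?subr_eq0 // addrC subr_eq0 eq_sym.
Qed.

Lemma rep_gen_comm u v m n F :
  rep (EGen u m) (rep (EGen v n) F) + rep (EGen v n) (rep (EGen u m) F)
  = (m%:~R * form u v *+ (m + n == 0)) *: F.
Proof.
transitivity (\sum_i \sum_j (gen_coef u m i * gen_coef v n j) *:
   (gen_mode m i (gen_mode n j F) + gen_mode n j (gen_mode m i F))).
  under [RHS]eq_bigr do under eq_bigr do rewrite scalerDr.
  under [RHS]eq_bigr do rewrite big_split /=.
  rewrite big_split /=; congr (_ + _).
    apply: eq_bigr => i _; rewrite linear_sum scaler_sumr /=.
    by apply: eq_bigr => j _; rewrite linearZ scalerA.
  rewrite exchange_big /=; apply: eq_bigr => j _; rewrite linear_sum scaler_sumr /=.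
  by apply: eq_bigr => i _; rewrite linearZ scalerA mulrC.
transitivity (\sum_i (gen_coef u m i * gen_coef v n i) *:
                (((m != 0) && (m + n == 0))%:R *: F)).
  apply: eq_bigr => i _; rewrite (bigD1 i) //= gen_mode_anticomm eqxx scale1r.
  rewrite big1 ?addr0 // => j nji.
  by rewrite gen_mode_anticomm eq_sym (negbTE nji) scale0r scaler0.
rewrite -scaler_suml scalerA; congr (_ *: _).
have [->|m0] /= := eqVneq m 0; first by rewrite mulr0 mul0r mul0rn.
have [mn|] /= := eqVneq (m + n) 0; last by rewrite mulr0.
have {mn} -> : n = - m by apply/eqP; rewrite -addr_eq0 addrC mn.
(* The modes m and -m: one of them creates and the other annihilates; for m < 0
   the roles are swapped and skew-symmetry restores the sign. *)
rewrite mulr1 mulr1n /gen_coef oppr_le0.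
case: (ltgtP m 0) m0 => // ltm _.
  rewrite form_sk form_xi mulrN -mulNr mulr_sumr; apply: eq_bigr => j _.
  by rewrite mulrC -mulrA rmorphN.
by rewrite form_xi mulr_sumr; apply: eq_bigr => j _; rewrite mulrA.
Qed.

Lemma rep_sf_eq x y : sf_eq form x y -> rep x = rep y.
Proof.
elim=> {x y} //=.
- by move=> x y z _ -> _ ->.
- by move=> x x' y y' _ -> _ ->.
- by move=> x x' _ ->.
- by move=> x x' y y' _ -> _ ->.
- by move=> a x x' _ ->.
- by move=> x y z; apply/funext => F; rewrite addrA.
- by move=> x y; apply/funext => F; rewrite addrC.
- by move=> x; apply/funext => F; rewrite add0r.
- by move=> x; apply/funext => F; rewrite addNr.
- by move=> x y z; apply/funext => F /=; rewrite linearD.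
- by move=> a c x; apply/funext => F; rewrite scalerA.
- by move=> x; apply/funext => F; rewrite scale1r.
- by move=> a x y; apply/funext => F; rewrite scalerDr.
- by move=> a c x; apply/funext => F; rewrite scalerDl.
- by move=> a x y; apply/funext => F; rewrite /= linearZ.
- move=> a u v n; apply/funext => F; rewrite scaler_sumr -big_split.
  apply: eq_bigr => j _; rewrite /= scalerA -scalerDl /gen_coef; congr (_ *: _).
  by case: ifP => _; rewrite ?xi_scalar // form_l mulrDr mulrCA.
- by move=> u v m n; apply/funext => F; apply: rep_gen_comm.
Qed.

Definition alg_rep (x : sf_alg form) : states -> states := rep (repr x).

Lemma alg_rep_class x : alg_rep (sf_class form x) = rep x.
Proof. exact/rep_sf_eq/sf_reprP. Qed.

Lemma alg_repM (x y : sf_alg form) F : alg_rep (x * y) F = alg_rep x (alg_rep y F).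
Proof.
elim/sf_ind: x => x; elim/sf_ind: y => y.
by rewrite [X in alg_rep X]/GRing.mul /= sf_pi_mul !alg_rep_class.
Qed.

Lemma alg_repD (x y : sf_alg form) F : alg_rep (x + y) F = alg_rep x F + alg_rep y F.
Proof.
elim/sf_ind: x => x; elim/sf_ind: y => y.
by rewrite [X in alg_rep X]/GRing.add /= sf_pi_add !alg_rep_class.
Qed.

(** The annihilator of the empty state is a left ideal containing the positive
modes, so the action on the empty state factors through the Fock space. *)
Lemma alg_rep_positive (x : sf_alg form) :
  sf_positive x -> alg_rep x empty_state = 0.
Proof.
apply: (@smallest_sub _ (@is_left_ideal k h form) _
  [set x | alg_rep x empty_state = 0]).
  split=> [|y z /= y0 z0|a y /= y0] /=.
  - by rewrite -[X in alg_rep X]/(sf_class form EZero) alg_rep_class.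
  - by rewrite alg_repD y0 z0 addr0.
  - by rewrite alg_repM y0; apply: linear0.
move=> _ [u [n [n0 ->]]] /=; rewrite alg_rep_class /= big1 // => j _.
by rewrite /gen_mode leNgt n0 mode_empty scaler0.
Qed.

(** The part of the Poincare-Birkhoff-Witt theorem that independence needs. *)
Lemma basis_word_neq0 (s : seq (J * nat)) :
  uniq s -> fock_word form [seq (b p.1, p.2) | p <- s] != 0.
Proof.
move=> us; apply/eqP => word0.
have /sf_projP : sf_proj (\prod_(p <- [seq (b p.1, p.2) | p <- s])
    sf_gen form p.1 (- p.2%:Z)) = sf_proj 0.
  rewrite -[LHS]/(sf_proj _) -[in LHS](mulr1 (\prod_(_ <- _) _)) -actE.
  by rewrite -[LHS]/(fock_word _ _) word0; apply/esym/(raddf0 (\pi_(fock form)%qT)).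
rewrite subr0 => /alg_rep_positive; rewrite big_map.
have -> : alg_rep (\prod_(p <- s) sf_gen form (b p.1) (- p.2%:Z)) empty_state
    = foldr (mode true) empty_state (map pickle s).
  elim: s {us word0} => [|[j n] s IH] /=.
    by rewrite big_nil -[X in alg_rep X]/(sf_class form EOne) alg_rep_class.
  rewrite big_cons alg_repM IH alg_rep_class /= (bigD1 j) //= big1 => [|i nij].
    rewrite addr0 /gen_mode /gen_coef oppr_le0 /= xi_b eqxx scale1r abszN.
    by rewrite absz_nat.
  by rewrite /gen_coef oppr_le0 /= xi_b (negbTE nij) scale0r.
move/(congr1 (fun F => F (fun i => i \in map pickle s)))/eqP.
by apply/negP/modes_neq0; rewrite map_inj_uniq //; apply: pcan_inj pickleK.
Qed.

End FockRepresentation.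

(** * Words span the Fock space, and the parity operator *)

Section FockSpace.
Context {k : fieldType} {h : lmodType k} {form : h -> h -> k}.
Implicit Types (u : h) (n : int) (x y : sf_alg form) (v w : fock form).

HB.instance Definition _ x := GRing.isLinear.Build k (fock form) (fock form) _
  (act x) (act_linear x).

Lemma actD x y v : act (x + y) v = act x v + act y v.
Proof. by elim/fock_ind: v => z; rewrite !actE -sf_projD mulrDl. Qed.

Lemma actZ a x v : act (a *: x) v = a *: act x v.
Proof.
by elim/fock_ind: v => z; rewrite !actE -[RHS]/(fock_scale _ _) fock_scaleE sf_scalerAl.
Qed.

Lemma act_gen_comm u u' m n v :
  act (sf_gen form u m) (act (sf_gen form u' n) v)
  + act (sf_gen form u' n) (act (sf_gen form u m) v)
  = (m%:~R * form u u' *+ (m + n == 0)) *: v.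
Proof.
rewrite -!actM -actD sf_gen_commP actZ; congr (_ *: _).
by elim/fock_ind: v => z; rewrite actE mul1r.
Qed.

Lemma act_zero_mode u u' v :
  act (sf_gen form u 0) (act (sf_gen form u' 0) v)
  = - act (sf_gen form u' 0) (act (sf_gen form u 0) v).
Proof.
by apply/eqP; rewrite -addr_eq0 act_gen_comm mul0r mul0rn scale0r.
Qed.

Lemma fock_word_cons u (n : nat) s :
  fock_word form ((u, n) :: s) = act (sf_gen form u (- n%:Z)) (fock_word form s).
Proof. by rewrite /fock_word big_cons actM. Qed.

Lemma act_vac x : act x (vac form) = sf_proj x.
Proof. by rewrite actE mulr1. Qed.

(** The span of the words is stable under all modes: a positive mode is moved to
the right through a word until it reaches the vacuum, which it kills. *)
Lemma fock_words_span v : span (range (fock_word form)) v.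
Proof.
set W := span _.
have [W0 WD] : is_subspace W := span_subspace _.
have Wstable (f : {linear fock form -> fock form}) :
    (forall s, W (f (fock_word form s))) -> forall w, W w -> W (f w).
  move=> Wf; suff : W `<=` [set w | W (f w)] by [].
  apply: span_min => [|_ [s _ <-]]; last exact: Wf.
  split=> [|a w w' Ww Ww'] /=; first by rewrite linear0.
  by rewrite linearP; apply: WD.
have Wcreate u (n : nat) w : W w -> W (act (sf_gen form u (- n%:Z)) w).
  apply: Wstable => s; rewrite /= -fock_word_cons.
  by apply: mem_span; exists ((u, n) :: s).
have Wgen u n w : W w -> W (act (sf_gen form u n) w).
  have [n0|n0] := lerP n 0.
    have -> : n = - `|n|%N%:Z by rewrite abszE ler0_norm // opprK.
    exact: Wcreate.
  apply: Wstable; elim=> [|[u' n'] s IH] /=.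
    rewrite /fock_word big_nil -actM mulr1 act_vac.
    have -> : sf_proj (sf_gen form u n) = sf_proj 0.
      apply/sf_projP; rewrite subr0; apply: sub_gen_smallest.
      by exists u, n.
    by rewrite [X in W X](raddf0 (\pi_(fock form)%qT)).
  rewrite fock_word_cons.
  have /(canRL (addrK _)) -> := act_gen_comm u u' n (- n'%:Z) (fock_word form s).
  rewrite -scaleN1r addrC; apply: WD; first by apply: Wcreate.
  by apply: spanZ; apply: mem_span; exists s.
have Wexpr (x : sf_expr k h) w : W w -> W (act (sf_class form x) w).
  elim: x w => [u n||||||].
  - exact: Wgen.
  - move=> w _; suff -> : act (sf_class form EZero) w = 0 by [].
    by rewrite -[sf_class _ _]/(0 : sf_alg form) -(scale0r 0) actZ scale0r.
  - elim/fock_ind => z Wz; rewrite -[sf_class _ _]/(1 : sf_alg form).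
    by rewrite actE mul1r.
  - move=> x IHx y IHy w Ww; rewrite -sf_pi_add actD -[act _ w]scale1r.
    by apply: WD; [apply: IHx | apply: IHy].
  - move=> x IHx w Ww; rewrite -sf_pi_opp.
    rewrite -[sf_opp _]/(- (sf_class form x)) -scaleN1r actZ.
    by apply: spanZ; apply: IHx.
  - by move=> x IHx y IHy w Ww; rewrite -sf_pi_mul actM; apply: IHx; apply: IHy.
  - by move=> a x IHx w Ww; rewrite -sf_pi_scale actZ; apply: spanZ; apply: IHx.
elim/fock_ind: v; elim/sf_ind => x; rewrite -act_vac; apply: Wexpr.
apply: mem_span; exists [::] => //.
by rewrite /fock_word big_nil act_vac.
Qed.

Lemma eq_on_words (f g : {linear fock form -> fock form}) :
  (forall s, f (fock_word form s) = g (fock_word form s)) -> f =1 g.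
Proof.
move=> fg v; move: (fock_words_span v).
suff : span (range (fock_word form)) `<=` [set v | f v = g v] by apply.
apply: span_min => [|_ [s _ <-]]; last exact: fg.
by split=> [|a u w /= fgu fgw] /=; rewrite ?(linear0 f) ?(linear0 g) // !linearP fgu fgw.
Qed.

Variable K : {linear fock form -> fock form}.
Hypothesis K_parity : is_parity_operator K.

Lemma parity_word s :
  K (fock_word form s) = (-1) ^+ size s *: fock_word form s.
Proof.
case: K_parity => _ Ke Ko; rewrite -signr_odd.
have [os|es] := boolP (odd (size s)).
  by rewrite Ko ?expr1 ?scaleN1r //; apply: mem_span; exists s.
by rewrite Ke ?scale1r //; apply: mem_span; exists s.
Qed.

Lemma parityK v : K (K v) = v.
Proof.
apply: (eq_on_words (f := K \o K) (g := idfun)) => s /=.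
by rewrite parity_word linearZ /= parity_word scalerA -expr2 sqrr_sign scale1r.
Qed.

Lemma parity_zero_mode u v :
  K (act (sf_gen form u 0) v) = - act (sf_gen form u 0) (K v).
Proof.
apply: (eq_on_words (f := K \o act (sf_gen form u 0))
  (g := GRing.opp \o (act (sf_gen form u 0) \o K))) => s /=.
rewrite parity_word linearZ /= -(fock_word_cons u 0) parity_word /= exprS mulN1r.
by rewrite scaleNr.
Qed.

End FockSpace.

(** * Counting even subsets *)

Section Counting.
Variable T : finType.
Local Open Scope nat_scope.

(** A parity-reversing involution of the subsets, hence a bijection between the
even and the odd ones. *)
Definition toggle (a : T) (S : {set T}) : {set T} :=
  if a \in S then (S :\ a)%SET else (a |: S)%SET.

Lemma toggleK a : involutive (toggle a).
Proof.
move=> S; rewrite /toggle; have [aS|aS] := boolP (a \in S).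
  by rewrite !inE eqxx /= finset.setD1K.
by rewrite setU11 finset.setU1K.
Qed.

Lemma odd_card_toggle a S : odd #|toggle a S| = ~~ odd #|S|.
Proof.
rewrite /toggle; case: ifP => aS; last by rewrite cardsU1 aS.
by rewrite [in RHS](cardsD1 a) aS /= negbK.
Qed.

Lemma card_even_sets (a : T) : #|[set S : {set T} | ~~ odd #|S|]%SET| = 2 ^ #|T|.-1.
Proof.
pose E := [set S : {set T} | ~~ odd #|S|]%SET.
have CE : (~: E = toggle a @: E)%SET.
  apply/setP => S; rewrite !inE negbK; apply/idP/imsetP => [oS|[S' + ->]].
    by exists (toggle a S); rewrite ?toggleK // inE odd_card_toggle oS.
  by rewrite inE odd_card_toggle.
have := cardsC E; rewrite CE card_imset; last exact: can_inj (toggleK a).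
rewrite addnn -cardsT -powersetT card_powerset cardsT.
have : 0 < #|T| by apply/card_gt0P; exists a.
by case: #|T| => // n _; rewrite expnS mul2n => /double_inj.
Qed.

Lemma card_central_index (a : T) : #|central_index (J := T)| = 2 ^ #|T|.-1 + 1.
Proof.
rewrite -(card_even_sets a) -(cards1 ([set: T]%SET, true)).
rewrite -(card_imset _ (f := fun S : {set T} => (S, false))); last first.
  by move=> S S' [].
rewrite -cardsUI [X in _ + X](_ : _ = 0) ?addn0; last first.
  apply: eq_card0 => -[S l]; rewrite !inE xpair_eqE.
  by apply/negP => /andP[/imsetP[S' _ [_ ->]]]; rewrite andbF.
apply: eq_card => -[S l]; rewrite !inE xpair_eqE /=; case: l; rewrite ?andbT ?andbF.
  by rewrite orb_idl // => /imsetP[].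
rewrite orbF; apply/idP/imsetP => [eS|[S' + [->]]]; last by rewrite inE.
by exists S; rewrite ?inE.
Qed.

End Counting.

Lemma card_eq_finset (T : finType) (F : {set T}) : ([set` F] #= `I_#|F|)%card.
Proof.
have -> : [set` F] = enum_val (A := mem F) @` [set: 'I_#|F|].
  apply/seteqP; split=> [x /= Fx|_ [i _ <-]]; last exact: enum_valP.
  by exists (enum_rank_in Fx x) => //; apply: enum_rankK_in.
apply: card_eq_trans (inj_card_eq (A := [set: 'I_#|F|]) _) _.
  by move=> i j _ _; apply: enum_val_inj.
by rewrite card_eq_sym; apply: card_II.
Qed.

(** * Coordinates in a symplectic basis *)

Section SymplecticBasis.
Context {k : fieldType} {h : vectType k} {d : nat}.
Variables (form : h -> h -> k) (phi psi : 'I_d -> h).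
Hypothesis form_symp : symplectic_form form.
Hypothesis basis : symplectic_basis form phi psi.

(** The Boolean selects [phi] (true) or [psi] (false).  The enumeration of pairs
lists true first, so indices come in the order e_1, f_1, e_2, f_2, and so on. *)
Definition darboux (j : 'I_d * bool) : h := if j.2 then phi j.1 else psi j.1.
Definition darboux_coord (j : 'I_d * bool) (v : h) : k :=
  if j.2 then form (psi j.1) v else - form (phi j.1) v.

Lemma darboux_coord_scalar j : scalar (darboux_coord j).
Proof.
move=> a u v; rewrite /darboux_coord; case: j.2; rewrite (form_linearr form_symp) //.
by rewrite opprD mulrN.
Qed.

Lemma darboux_coordE i j : darboux_coord i (darboux j) = (i == j)%:R.
Proof.
case: i j => [i []] [j []]; rewrite /darboux_coord /darboux xpair_eqE /=.
- by rewrite (sb_psi_phi basis) andbT eq_sym.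
- by rewrite (sb_psi basis) andbF.
- by rewrite (sb_phi basis) andbF oppr0.
- by rewrite (sb_phi_psi basis) opprK andbT.
Qed.

Lemma eq_on_darboux (f g : h -> k) : scalar f -> scalar g ->
  (forall j, f (darboux j) = g (darboux j)) -> f =1 g.
Proof.
move=> Lf Lg fg v.
have := coord_basis (X := in_tuple _) (sb_basis basis) (memvf v) => ->.
apply: (big_rec (fun v => f v = g v)) => [|i w _ fgw].
  have := Lf (-1) 0 0; have := Lg (-1) 0 0.
  by rewrite scaleN1r addNr !mulN1r !addNr => -> ->.
rewrite Lf Lg fgw; congr (_ * _ + _).
have : (in_tuple (codom phi ++ codom psi))`_i \in codom phi ++ codom psi.
  by apply: mem_nth; case: i => /=.
rewrite mem_cat => /orP[] /codomP[j ->].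
  exact: (fg (j, true)).
exact: (fg (j, false)).
Qed.

Lemma darboux_expand u v : form u v = \sum_j form u (darboux j) * darboux_coord j v.
Proof.
move: v; apply: eq_on_darboux => [|a v w|j].
- exact: (form_linearr form_symp).
- rewrite mulr_sumr -big_split; apply: eq_bigr => j _ /=.
  by rewrite darboux_coord_scalar mulrDr mulrCA.
- rewrite (bigD1 j) //= darboux_coordE eqxx mulr1 big1 ?addr0 // => i nij.
  by rewrite darboux_coordE (negbTE nij) mulr0.
Qed.

End SymplecticBasis.

(** * The algebra of zero modes *)

Section ZeroModeAlgebra.
Context {k : fieldType} {h : vectType k} {d : nat}.
Variables (form : h -> h -> k) (phi psi : 'I_d -> h).

Definition zero_mode (j : 'I_d * bool) : {linear fock form -> fock form} :=
  act (sf_gen form (darboux phi psi j) 0).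

Lemma word_zero_mode l s :
  word zero_mode l (fock_word form s)
  = fock_word form ([seq (darboux phi psi j, 0%N) | j <- l] ++ s).
Proof. by elim: l => //= j l ->; rewrite fock_word_cons. Qed.

Definition exponent_set (m n : 'I_d -> bool) : {set 'I_d * bool} :=
  [set j | if j.2 then m j.1 else n j.1].

Lemma exponent_setK (S : {set 'I_d * bool}) :
  exponent_set (fun i => (i, true) \in S) (fun i => (i, false) \in S) = S.
Proof. by apply/setP => -[i []]; rewrite inE. Qed.

Lemma enum_mode :
  enum {: 'I_d * bool} = [seq (i, b) | i <- enum 'I_d, b <- [:: true; false]].
Proof.
have boolE : enum {: bool} = [:: true; false] by rewrite enumT unlock.
by rewrite enumT unlock /= /prod_enum boolE.
Qed.

Lemma monomialE m n :
  monomial phi psi m n = word zero_mode (enum (exponent_set m n))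
  :> (fock form -> fock form).
Proof.
rewrite /monomial.
have -> : index_enum 'I_d = enum 'I_d by rewrite enumT /index_enum; case: index_enum_key.
rewrite {2}/enum_mem -enumT enum_mode.
elim: (enum 'I_d) => [|i r IH]; first by rewrite big_nil.
apply/funext => v; rewrite big_cons /= IH !inE /=.
by case: (m i); case: (n i).
Qed.

Lemma OmegaE (K : {linear fock form -> fock form}) :
  Omega phi psi K = range (signed_mono zero_mode K).
Proof.
apply/seteqP; split=> [_ [m [n [l ->]]]|_ [[S l] _ <-]].
  by exists (exponent_set m n, l) => //; rewrite /signed_mono monomialE.
exists (fun i => (i, true) \in S), (fun i => (i, false) \in S), l.
by rewrite monomialE exponent_setK.
Qed.

Lemma sum_exponent (m n : 'I_d -> bool) :
  (\sum_(i < d) (m i + n i))%N = #|exponent_set m n|.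
Proof.
transitivity (\sum_(i < d) \sum_(b : bool) ((i, b) \in exponent_set m n : nat))%N.
  by apply: eq_bigr => i _; rewrite big_bool !inE.
rewrite pair_bigA -sum1_card [RHS]big_mkcond /=.
by apply: eq_bigr => -[i b] _ /=; case: (_ \in _).
Qed.

Lemma ZOmegaE (K : {linear fock form -> fock form}) :
  ZOmega phi psi K =
  signed_mono zero_mode K @` [set` @central_index ('I_d * bool)%type].
Proof.
have topE : (\big[comp/id]_(i < d) (op_e phi i \o op_f psi i) : fock form -> fock form)
    = word zero_mode (enum [set: 'I_d * bool]%SET).
  rewrite -[LHS]/(monomial phi psi (fun=> true) (fun=> true)) monomialE.
  rewrite (_ : exponent_set _ _ = [set: _]%SET) //.
  by apply/setP => -[i []]; rewrite !inE.
apply/seteqP; split=> [_ [[m [n [even_mn ->]]]|->]|_ [[S l] /= + <-]].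
- exists (exponent_set m n, false); first by rewrite /= inE /= -sum_exponent.
  by rewrite monomialE.
- exists ([set: 'I_d * bool]%SET, true); first by rewrite /= inE /=.
  by rewrite topE.
rewrite inE /=; case: l => [/eqP ->|eS]; first by right; rewrite topE.
left; exists (fun i => (i, true) \in S), (fun i => (i, false) \in S).
by rewrite sum_exponent monomialE exponent_setK.
Qed.

Lemma P_algE (K : {linear fock form -> fock form}) :
  P_alg phi psi K = generated_algebra
    (range (fun j => zero_mode j : fock form -> fock form)
     `|` [set (K : fock form -> fock form)]).
Proof.
congr (generated_algebra (_ `|` _)); apply/seteqP; split.
  by move=> _ [[i _ <-]|[i _ <-]]; [exists (i, true) | exists (i, false)].
by move=> _ [[i []] _ <-]; [left | right]; exists i.
Qed.

End ZeroModeAlgebra.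

Theorem proposition6p1p3 (R : realType) (d : nat) (h : vectType R[i])
    (form : h -> h -> R[i]) (phi psi : 'I_d -> h)
    (K : fock form -> fock form) :
  (1 <= d)%N ->
  \dim {:h} = (2 * d)%N ->
  symplectic_form form ->
  symplectic_basis form phi psi ->
  is_parity_operator K ->
  [/\ is_basis (Omega phi psi K) (P_alg phi psi K),
      ZOmega phi psi K `<=` Omega phi psi K,
      is_basis (ZOmega phi psi K) (center (P_alg phi psi K)) &
      has_dim (center (P_alg phi psi K)) (2 ^ (2 * d - 1) + 1)%N].
Proof.
move=> d_gt0 _ form_symp basis K_parity.
have [K_linear _ _] := K_parity.
pose KL : {linear fock form -> fock form} :=
  HB.pack K (GRing.isLinear.Build _ _ _ _ K K_linear).
have KL_parity : is_parity_operator KL by [].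
pose j0 : 'I_d * bool := (Ordinal d_gt0, true).
pose t := zero_mode form phi psi.
have two : (2%:R : R[i]) != 0 by rewrite pnatr_eq0.
have t_anti i j v : t i (t j v) = - t j (t i v) by apply: act_zero_mode.
have Kt j v : KL (t j v) = - t j (KL v) by apply: parity_zero_mode.
have KK := parityK KL_parity.
have cardJ : #|{: 'I_d * bool}| = (2 * d)%N by rewrite card_prod card_ord card_bool mulnC.
have word_neq0 := basis_word_neq0 (form_linearl form_symp) (form_skew form_symp)
  (darboux_coord_scalar phi psi form_symp) (darboux_coordE basis)
  (darboux_expand form_symp basis).
(* Nonzero levels in [s] keep the list of sites duplicate-free once all the zero
   modes are prepended. *)
have top_neq0 s : uniq s -> all (fun p => p.2 != 0%N) s ->
    word t (enum {: 'I_d * bool})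
      (fock_word form [seq (darboux phi psi p.1, p.2) | p <- s]) != 0.
  move=> us s_pos; rewrite word_zero_mode.
  have -> : [seq (darboux phi psi j, 0%N) | j <- enum {: 'I_d * bool}] =
     [seq (darboux phi psi p.1, p.2) | p <- [seq (j, 0%N) | j <- enum {: 'I_d * bool}]].
    by rewrite -[RHS]map_comp; apply: eq_map.
  rewrite -map_cat; apply: word_neq0; rewrite cat_uniq us andbT.
  rewrite map_inj_uniq ?enum_uniq => [|i j []] //=.
  apply/hasPn => p /(allP s_pos) p0; apply/mapP => -[j _ pj].
  by rewrite pj in p0.
have Kword s := parity_word KL_parity s.
have Kvp : KL (fock_word form [::]) = fock_word form [::].
  by rewrite Kword scale1r.
have Kvm : KL (fock_word form [:: (darboux phi psi j0, 1%N)])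
         = - fock_word form [:: (darboux phi psi j0, 1%N)].
  by rewrite Kword expr1 scaleN1r.
have top_vp := top_neq0 [::] isT isT.
have top_vm := top_neq0 [:: (j0, 1%N)] isT isT.
have free := signed_mono_free two t_anti Kvp Kvm top_vp top_vm.
rewrite -[K]/(KL : fock form -> fock form) OmegaE ZOmegaE P_algE.
have algebra_basis := signed_mono_basis two t_anti KK Kt Kvp Kvm top_vp top_vm.
have center_basis := signed_mono_center_basis two t_anti KK Kt Kvp Kvm top_vp top_vm.
rewrite cardJ oddM /= in center_basis.
split.
- exact: algebra_basis.
- by move=> _ [i _ <-]; exists i.
- exact: center_basis.
exists (signed_mono t KL @` [set` @central_index ('I_d * bool)%type]).
split; first exact: center_basis.
have <- : #|@central_index ('I_d * bool)%type| = (2 ^ (2 * d - 1) + 1)%N.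
  by rewrite (card_central_index j0) cardJ subn1.
apply: card_eq_trans (inj_card_eq _) (card_eq_finset _).
by move=> i j _ _; apply: free_family_inj.
Qed.
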